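(* Let $n,m\ge2$. If $n\ne m$, then $\mathrm{Aut}(F_n\times F_m)\cong\mathrm{Aut}(F_n)\times\mathrm{Aut}(F_m)$. If $n=m$, let $\theta_n\in\mathrm{Aut}(F_n\times F_n)$ be the involution $(x,y)\mapsto(y,x)$; then $\mathrm{Aut}(F_n\times F_n)$ is the semidirect product of $\mathrm{Aut}(F_n)\times\mathrm{Aut}(F_n)$ and $\langle\theta_n\rangle$.
   Context: $F_n,F_m$ are free groups of ranks $n,m$. $\mathrm{Aut}(F_n)\times\mathrm{Aut}(F_n)$ is regarded as the subgroup of $\mathrm{Aut}(F_n\times F_n)$ consisting of the automorphisms acting componentwise, $(x,y)\mapsto(x\phi,y\psi)$ with $\phi,\psi\in\mathrm{Aut}(F_n)$. *)

(* Defs.v *)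
From HB Require Import structures.
From mathcomp Require Import all_boot.
From mathcomp Require Import boolp classical_sets.

Set Implicit Arguments.
Unset Strict Implicit.
Unset Printing Implicit Defensive.

Local Open Scope group_scope.

Section ReducedWords.
Variable X : eqType.

(* The letter (x, true) stands for x and (x, false) for its inverse. *)
Definition letter_inv (a : X * bool) : X * bool := (a.1, ~~ a.2).

Definition reduced (w : seq (X * bool)) : bool :=
  sorted (fun a b => b != letter_inv a) w.

Definition push (a : X * bool) (w : seq (X * bool)) : seq (X * bool) :=
  if w is b :: w' then if b == letter_inv a then w' else a :: w else [:: a].

(* The reduced form of u ++ w, for w reduced. *)
Definition word_act (u w : seq (X * bool)) : seq (X * bool) := foldr push w u.

Definition word_inv (u : seq (X * bool)) : seq (X * bool) :=
  rev (map letter_inv u).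

Lemma letter_invK : involutive letter_inv.
Proof. by case=> x b; rewrite /letter_inv /= negbK. Qed.

Lemma push_reduced a w : reduced w -> reduced (push a w).
Proof.
case: w => [|b w] //= w_red; case: eqP => [_|/eqP ba].
  exact: path_sorted w_red.
by rewrite /reduced /= ba.
Qed.

Lemma pushK a w : reduced w -> push (letter_inv a) (push a w) = w.
Proof.
case: w => [|b w] /=; first by rewrite letter_invK eqxx.
case: eqP => [->|_] w_red; last by rewrite /= letter_invK eqxx.
by case: w w_red => //= c w /andP[/negPf-> _].
Qed.

Lemma word_act_reduced u w : reduced w -> reduced (word_act u w).
Proof. by move=> w_red; elim: u => //= a u; apply: push_reduced. Qed.

Lemma word_act0 u : reduced u -> word_act u [::] = u.
Proof.
elim: u => //= a u IH au_red; rewrite IH; last exact: path_sorted au_red.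
by case: u au_red {IH} => //= b u /andP[/negPf-> _].
Qed.

Lemma word_act_push a t w :
  reduced w -> word_act (push a t) w = push a (word_act t w).
Proof.
move=> w_red; case: t => [|b t] //=; case: eqP => [->|_] //=.
by rewrite -{1}[a]letter_invK pushK // word_act_reduced.
Qed.

Lemma word_actA u v w :
  reduced w -> word_act (word_act u v) w = word_act u (word_act v w).
Proof. by move=> w_red; elim: u => //= a u IH; rewrite word_act_push // IH. Qed.

Lemma word_inv_reduced u : reduced u -> reduced (word_inv u).
Proof.
rewrite /reduced /word_inv rev_sorted sorted_map; apply: sub_sorted => a b /=.
by rewrite letter_invK; apply: contraNneq => ->.
Qed.

Lemma word_invK : involutive word_inv.
Proof. by move=> u; rewrite /word_inv map_rev revK mapK //; apply: letter_invK. Qed.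

Lemma word_actVu u : word_act (word_inv u) u = [::].
Proof.
elim: u => //= a u IH.
by rewrite /word_inv /= rev_cons /word_act foldr_rcons /= letter_invK eqxx.
Qed.

End ReducedWords.

Record free_group (X : choiceType) := FreeGroup {
  free_word :> seq (X * bool);
  free_wordP : reduced free_word
}.

HB.instance Definition _ (X : choiceType) :=
  [isSub of free_group X for @free_word X].
HB.instance Definition _ (X : choiceType) :=
  [Choice of free_group X by <:].

Section FreeGroupLaws.
Variable X : choiceType.
Implicit Types u v w : free_group X.

Definition free_one : free_group X := @FreeGroup X [::] isT.
Definition free_mul u v : free_group X :=
  FreeGroup (word_act_reduced u (free_wordP v)).
Definition free_inv u : free_group X :=
  FreeGroup (word_inv_reduced (free_wordP u)).

Fact free_mulA : associative free_mul.
Proof.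
by move=> u v w; apply: val_inj; rewrite /= word_actA //; apply: free_wordP.
Qed.
Fact free_mul1 : left_id free_one free_mul.
Proof. by move=> u; apply: val_inj. Qed.
Fact free_mulr1 : right_id free_one free_mul.
Proof. by move=> u; apply: val_inj; apply: word_act0 (free_wordP u). Qed.
Fact free_mulV : left_inverse free_one free_inv free_mul.
Proof. by move=> u; apply: val_inj; apply: word_actVu. Qed.
Fact free_mulrV : right_inverse free_one free_inv free_mul.
Proof.
move=> u; apply: val_inj => /=.
by rewrite -[X in word_act X](word_invK (val u)) word_actVu.
Qed.

HB.instance Definition _ := isGroup.Build (free_group X)
  free_mulA free_mul1 free_mulr1 free_mulV free_mulrV.

Definition free_gen (x : X) : free_group X := @FreeGroup X [:: (x, true)] isT.

End FreeGroupLaws.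

Definition free_of_rank (n : nat) : groupType := free_group 'I_n.

Section UniversalProperty.
Variables (X : choiceType) (G : groupType) (f : X -> G).

Definition letter_val (a : X * bool) : G := if a.2 then f a.1 else (f a.1)^-1.
Definition free_lift (u : free_group X) : G :=
  \prod_(a <- free_word u) letter_val a.

Lemma letter_valV a : letter_val (letter_inv a) = (letter_val a)^-1.
Proof. by case: a => x [] //=; rewrite /letter_val /= invgK. Qed.

Lemma free_liftM : {morph free_lift : u v / u * v}.
Proof.
move=> u v; rewrite /free_lift /=.
elim: (free_word u) => [|a s IH] /=; first by rewrite big_nil mul1g.
rewrite big_cons -mulgA -IH; case: (word_act s v) => [|b t] /=.
  by rewrite big_cons.
case: eqP => [->|_]; last by rewrite big_cons.
by rewrite big_cons letter_valV mulVKg.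
Qed.

Lemma free_lift_gen x : free_lift (free_gen x) = f x.
Proof. by rewrite /free_lift big_seq1. Qed.

Lemma free_lift_unique (g : free_group X -> G) :
  {morph g : u v / u * v} -> (forall x, g (free_gen x) = f x) ->
  g =1 free_lift.
Proof.
move=> gM gf.
have g1 : g 1 = 1 by apply: (mulgI (g 1)); rewrite -gM !mulg1.
have gV u : g u^-1 = (g u)^-1.
  by apply: (mulgI (g u)); rewrite -gM !mulgV.
case=> s; elim: s => [|a s IH] s_red.
  rewrite /free_lift big_nil -[RHS]g1; congr g; exact: val_inj.
have s_red' : reduced s by apply: path_sorted s_red.
have -> : FreeGroup s_red =
    (if a.2 then free_gen a.1 else (free_gen a.1)^-1) * FreeGroup s_red'.
  apply: val_inj => /=; rewrite -[LHS](word_act0 s_red) /= word_act0 //.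
  by case: a {s_red} => x [].
rewrite gM IH free_liftM /free_lift; congr (_ * _).
case: a {s_red} => x []; last rewrite gV.
  by rewrite gf big_seq1.
by rewrite gf big_seq1.
Qed.

End UniversalProperty.

Definition is_aut (G : groupType) (f : G -> G) : Prop :=
  {morph f : x y / x * y} /\ bijective f.

Record Aut (G : groupType) := MkAut {
  aut_fun :> G -> G;
  aut_funP : `[< is_aut aut_fun >]
}.

HB.instance Definition _ (G : groupType) := [isSub of Aut G for @aut_fun G].
HB.instance Definition _ (G : groupType) := [Choice of Aut G by <:].

Section AutGroup.
Variable G : groupType.
Implicit Types f g h : Aut G.

Lemma autP f : is_aut f. Proof. exact: asboolW (aut_funP f). Qed.

Lemma aut_surj f y : exists x, f x == y.
Proof. by have [_ [f' _ fK]] := autP f; exists (f' y); rewrite fK. Qed.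

Fact is_aut_id : is_aut (@id G).
Proof. by split=> //; exists id. Qed.
Fact is_aut_comp f g : is_aut (g \o f).
Proof.
have [[fM fB] [gM gB]] := (autP f, autP g); split; last exact: bij_comp.
by move=> x y; rewrite /= fM gM.
Qed.
Definition aut_inv_fun f (y : G) : G := xchoose (aut_surj f y).
Fact aut_invK f : cancel (aut_inv_fun f) f.
Proof. by move=> y; apply/eqP/(xchooseP (aut_surj f y)). Qed.
Fact aut_funK f : cancel f (aut_inv_fun f).
Proof. by move=> x; have [_ /bij_inj fI] := autP f; apply: fI; rewrite aut_invK. Qed.
Fact is_aut_inv f : is_aut (aut_inv_fun f).
Proof.
have [fM /bij_inj fI] := autP f; split.
  by move=> x y; apply: fI; rewrite fM !aut_invK.
by exists f; [apply: aut_invK | apply: aut_funK].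
Qed.

Definition aut_one : Aut G := MkAut (asboolT is_aut_id).
(* Automorphisms act on the right: the product f g is f followed by g. *)
Definition aut_mul f g : Aut G := MkAut (asboolT (is_aut_comp f g)).
Definition aut_inv f : Aut G := MkAut (asboolT (is_aut_inv f)).

Fact aut_mulA : associative aut_mul.
Proof. by move=> f g h; apply: val_inj. Qed.
Fact aut_mul1 : left_id aut_one aut_mul.
Proof. by move=> f; apply: val_inj. Qed.
Fact aut_mulr1 : right_id aut_one aut_mul.
Proof. by move=> f; apply: val_inj. Qed.
Fact aut_mulV : left_inverse aut_one aut_inv aut_mul.
Proof. by move=> f; apply/val_inj/funext => x; apply: aut_invK. Qed.
Fact aut_mulrV : right_inverse aut_one aut_inv aut_mul.
Proof. by move=> f; apply/val_inj/funext => x; apply: aut_funK. Qed.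

HB.instance Definition _ := isGroup.Build (Aut G)
  aut_mulA aut_mul1 aut_mulr1 aut_mulV aut_mulrV.

End AutGroup.

Definition isomorphic (G H : groupType) : Prop :=
  exists f : {multiplicative G -> H}, bijective f.

Definition cyclic_subgroup (G : groupType) (x : G) : set G :=
  [set y | exists k : nat, y = x ^+ k \/ y = x ^- k].

(* G is the internal semidirect product of its normal subgroup N and of H. *)
Definition is_semidirect (G : groupType) (N H : set G) : Prop :=
  [/\ group_closed [in N],
      group_closed [in H],
      forall x y : G, N x -> N (x ^ y),
      (N `&` H)%classic = [set 1]%classic
    & forall g : G, exists x y : G, [/\ N x, H y & g = x * y]].

Section Componentwise.
Variables G H : groupType.

Definition prod_aut_fun (p : Aut G * Aut H) (z : G * H) : G * H :=
  (p.1 z.1, p.2 z.2).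

Fact is_aut_prod p : is_aut (prod_aut_fun p).
Proof.
have [[fM [f' fK f'K]] [gM [g' gK g'K]]] := (autP p.1, autP p.2); split.
  by move=> [x1 x2] [y1 y2]; rewrite /prod_aut_fun /= fM gM.
exists (fun z => (f' z.1, g' z.2)) => -[x y];
  by rewrite /prod_aut_fun /= ?fK ?gK ?f'K ?g'K.
Qed.

Definition prod_aut (p : Aut G * Aut H) : Aut (G * H)%type :=
  MkAut (asboolT (is_aut_prod p)).

Lemma prod_autM : {morph prod_aut : p q / p * q}.
Proof. by move=> p q; apply: val_inj. Qed.

Lemma prod_aut_inj : injective prod_aut.
Proof.
move=> [f g] [f' g'] /(congr1 val) /= E.
congr (_, _); apply/val_inj/funext => x /=.
  by have /(congr1 fst) := congr1 (fun k => k (x, 1)) E.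
by have /(congr1 snd) := congr1 (fun k => k (1, x)) E.
Qed.

(* Aut G * Aut H viewed as a subgroup of Aut (G * H). *)
Definition componentwise_auts : set (Aut (G * H)%type) := range prod_aut.

End Componentwise.

Arguments componentwise_auts : clear implicits.

Section Swap.
Variable G : groupType.

Fact is_aut_swap : is_aut (fun z : G * G => (z.2, z.1)).
Proof. by split=> //; exists (fun z => (z.2, z.1)) => -[]. Qed.

Definition swap_aut : Aut (G * G)%type := MkAut (asboolT is_aut_swap).

Lemma swap_autE x y : swap_aut (x, y) = (y, x).
Proof. by []. Qed.

Lemma swap_aut_involution : swap_aut ^+ 2 = 1.
Proof. by apply/val_inj/funext => -[x y]. Qed.

End Swap.

Lemma swap_aut_neq1 (n : nat) :
  0 < n -> swap_aut (free_of_rank n) <> 1.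
Proof.
move=> n_gt0 /(congr1 (fun f : Aut _ => f (free_gen (Ordinal n_gt0), 1))).
by case.
Qed.

(* Main.v *)
(* Let F be an automorphism of the product of two free groups. The projections
   of the images under F of the two factors to a fixed free factor are commuting
   subgroups that together generate it, and this forces one of them to be
   trivial: an element commuting with a generator a is a power of a, and
   nontrivial powers of distinct generators do not commute. Hence F either acts
   componentwise or exchanges the two factors, and the latter maps each free
   group onto the other, which is only possible when the ranks agree. *)
From HB Require Import structures.
Require Import Defs.
From mathcomp Require Import all_boot.
From mathcomp Require Import boolp classical_sets.
From mathcomp Require Import perm.

Set Implicit Arguments.
Unset Strict Implicit.
Unset Printing Implicit Defensive.

Local Open Scope group_scope.

(** * Centralizers of generators and commuting factors in a free group *)

Section FreeGroupCentralizers.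
Variable X : choiceType.
Implicit Types (a b : X) (u v : free_group X).

Lemma size_word_act (s t : seq (X * bool)) :
  size (word_act s t) <= size s + size t.
Proof.
elim: s => //= c s IH; rewrite addSn; case: (word_act s t) IH => //= d r IH.
by case: ifP => _ //=; rewrite ltnW // ltnS (leq_trans _ IH).
Qed.

Lemma free_wordM_cat u v :
  reduced (free_word u ++ free_word v) ->
  free_word (u * v) = free_word u ++ free_word v.
Proof.
move=> uv_red; rewrite /= -{1}(word_act0 (free_wordP v)) -[LHS]foldr_cat.
exact: word_act0.
Qed.

(** The two letters meeting at the junction belong to different generators, so they cannot
    cancel. *)
Lemma reduced_cat_disjoint a b (s t : seq (X * bool)) : a != b ->
  all (fun c => c.1 == a) s -> all (fun c => c.1 == b) t ->
  reduced s -> reduced t -> reduced (s ++ t).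
Proof.
move=> ab; case: s => // c s sa; case: t => [|d t]; first by rewrite cats0.
rewrite /reduced /= cat_path => /andP[/eqP db _] -> /= ->; rewrite andbT.
apply: contraNneq ab => dE.
by move/allP/(_ _ (mem_last c s)): sa => /eqP <-; rewrite -db dE.
Qed.

(* If the reduced word of u starts with a letter c other than a and its
   inverse, then the word of a * u starts with a c, whereas the word of u * a
   is too short for a cancellation against c to produce this. *)
Lemma commute_free_gen a u :
  commute u (free_gen a) -> all (fun c => c.1 == a) (free_word u).
Proof.
have [k] := ubnP (size (free_word u)); elim: k u => // k IH [[//|c s] u_red].
move=> /= size_s cu.
have s_red : reduced s by apply: path_sorted u_red.
have uE : FreeGroup u_red =
    (if c.2 then free_gen c.1 else (free_gen c.1)^-1) * FreeGroup s_red.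
  apply: val_inj => /=; rewrite -[LHS](word_act0 u_red) /= word_act0 //.
  by case: c {u_red cu size_s} => x [].
have [ca|ca] /= := eqVneq c.1 a.
  (* A first letter over [a] commutes with [a]; dividing it out leaves a shorter word that still
     commutes with [a]. *)
  apply: (IH (FreeGroup s_red)) => //; apply/commute_sym.
  move/commute_sym: cu; rewrite uE ca; set g := if _ then _ else _ => cu.
  have cg : commute (free_gen a) g.
    by rewrite /g; case: ifP => // _; apply: commuteV.
  by rewrite -[FreeGroup s_red](mulKg g); apply/commuteM/cu/commuteV.
have /= := congr1 (@free_word X) cu.
have -> : (c == letter_inv (a, true)) = false.
  by apply: contraNF ca => /eqP ->.
have := size_word_act s [:: (a, true)].
case: (word_act s _) => [|d r] /=; first by move=> _ [cE]; rewrite cE eqxx in ca.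
case: ifP => [_|_] size_r; last by case=> cE; rewrite cE eqxx in ca.
by move=> rE; move: size_r; rewrite rE /= addn1 !ltnS ltnNge leqnSn.
Qed.

(** The words of [u] and [v] involve only [a] and only [b], so [u * v] and [v * u] are plain
    concatenations. If both words are nonempty, the first letters of these products differ. *)
Lemma commute_centralizers a b u v : a != b ->
  commute u (free_gen a) -> commute v (free_gen b) -> commute u v ->
  u = 1 \/ v = 1.
Proof.
move=> ab /commute_free_gen ua /commute_free_gen vb uv.
have ba : b != a by rewrite eq_sym.
have := congr1 (@free_word X) uv.
rewrite !free_wordM_cat;
  try by [apply: reduced_cat_disjoint ua vb _ _ => //; apply: free_wordP
         |apply: reduced_cat_disjoint vb ua _ _ => //; apply: free_wordP].
case uE: (free_word u) ua => [|c s] /=; first by left; apply: val_inj.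
case vE: (free_word v) vb => [|d t] /=; first by right; apply: val_inj.
move=> /andP[/eqP db _] /andP[/eqP ca _] [cd _].
by rewrite -ca cd db eqxx in ab.
Qed.

Lemma free_gen_neq1 a : free_gen a <> 1.
Proof. by move/(congr1 (@free_word X)). Qed.

Lemma free_group_center a b u : a != b ->
  commute u (free_gen a) -> commute u (free_gen b) -> u = 1.
Proof. by move=> ab ua ub; case: (commute_centralizers ab ua ub). Qed.

(* Write a = p * q and b = p' * q' with p, p' values of f and q, q' values of g:
   p and q commute with a, and p' and q' with b. As p commutes with q' and p'
   with q, one element of each of these pairs is trivial. *)
Lemma commuting_factors (S T : Type) (f : S -> free_group X)
    (g : T -> free_group X) a b : a != b ->
  (forall x y, commute (f x) (g y)) ->
  (forall u, exists x y, u = f x * g y) ->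
  (forall x, f x = 1) \/ (forall y, g y = 1).
Proof.
move=> ab fg fgT.
have [x [y aE]] := fgT (free_gen a); have [x' [y' bE]] := fgT (free_gen b).
have fa : commute (f x) (free_gen a) by rewrite aE; apply: commuteM.
have ga : commute (g y) (free_gen a).
  by rewrite aE; apply: commuteM => //; apply: commute_sym.
have fb : commute (f x') (free_gen b) by rewrite bE; apply: commuteM.
have gb : commute (g y') (free_gen b).
  by rewrite bE; apply: commuteM => //; apply: commute_sym.
have ba : b != a by rewrite eq_sym.
have [fx1|gy'1] := commute_centralizers ab fa gb (fg _ _).
  have [fx'1|gy1] := commute_centralizers ba fb ga (fg _ _).
    (* Now [a = g y] and [b = g y'], so every value of [f] commutes with two distinct generators. *)
    left=> z; apply: (free_group_center ab).
      by rewrite aE fx1 mul1g.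
    by rewrite bE fx'1 mul1g.
  by case: (@free_gen_neq1 a); rewrite aE fx1 gy1 mul1g.
have [fx'1|gy1] := commute_centralizers ba fb ga (fg _ _).
  by case: (@free_gen_neq1 b); rewrite bE fx'1 gy'1 mul1g.
right=> z; apply: (free_group_center ab); apply: commute_sym.
  by rewrite aE gy1 mulg1.
by rewrite bE gy'1 mulg1.
Qed.

End FreeGroupCentralizers.

(* Counts homomorphisms to a group of order two: composition with h embeds
   those of the target into those of the source. *)
Lemma free_rank_leq (n m : nat) (h : free_of_rank n -> free_of_rank m) :
  {morph h : u v / u * v} -> (forall v, exists u, h u = v) -> m <= n.
Proof.
move=> hM h_surj.
(* This group has 2! = 2 elements, so the count yields 2^m <= 2^n. *)
pose G := {perm 'I_2}.
pose pull (f : {ffun 'I_m -> G}) : {ffun 'I_n -> G} :=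
  [ffun i => free_lift f (h (free_gen i))].
have pull_inj : injective pull.
  move=> f f' ff'; have eq_lift v : free_lift f v = free_lift f' v.
    have [u <-] := h_surj v.
    (* Both sides are homomorphisms in [w] that agree on the generators; as [h] is onto, [pull e]
       thus determines the lift of [e]. *)
    have liftE (e : {ffun 'I_m -> G}) w :
        free_lift e (h w) = free_lift (pull e) w.
      apply: (@free_lift_unique _ _ (pull e) (free_lift e \o h)) => [w1 w2|i].
        by rewrite /= hM free_liftM.
      by rewrite ffunE.
    by rewrite !liftE ff'.
  by apply/ffunP => i; rewrite -(free_lift_gen f) eq_lift free_lift_gen.
have := leq_card pull pull_inj.
by rewrite !card_ffun !card_ord card_Sn leq_exp2l.
Qed.

(** * Automorphisms of a direct product of two groups *)

Lemma Aut_surj (G : groupType) (F : Aut G) z : exists t, F t = z.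
Proof. by have [t /eqP] := aut_surj F z; exists t. Qed.

Lemma Aut_inj (G : groupType) (F : Aut G) : injective F.
Proof. by have [_ /bij_inj] := autP F. Qed.

Lemma pairM (G H : groupType) (x x' : G) (y y' : H) :
  (x, y) * (x', y') = (x * x', y * y').
Proof. by []. Qed.

Section AutProduct.
Variables G H : groupType.
Implicit Type F : Aut (G * H)%type.

Lemma Aut_pairE F x y : F (x, y) = F (x, 1) * F (1, y).
Proof. by have [<- _] := autP F; rewrite pairM mulg1 mul1g. Qed.

Lemma Aut_pair_commute F x y : commute (F (x, 1)) (F (1, y)).
Proof. by have [FM _] := autP F; rewrite /commute -!FM !pairM !mulg1 !mul1g. Qed.

Lemma Aut_pairMl F x x' : F (x * x', 1) = F (x, 1) * F (x', 1).
Proof. by have [<- _] := autP F; rewrite pairM mulg1. Qed.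

Lemma Aut_pairMr F y y' : F (1, y * y') = F (1, y) * F (1, y').
Proof. by have [<- _] := autP F; rewrite pairM mulg1. Qed.

Lemma componentwise_autsP F :
  (forall x, (F (x, 1)).2 = 1) -> (forall y, (F (1, y)).1 = 1) ->
  componentwise_auts G H F.
Proof.
move=> F21 F12.
have FE x y : F (x, y) = ((F (x, 1)).1, (F (1, y)).2).
  rewrite Aut_pairE [F (x, 1)]surjective_pairing [F (1, y)]surjective_pairing.
  by rewrite pairM F21 F12 mulg1 mul1g.
have F1l x : F (x, 1) = ((F (x, 1)).1, 1).
  by rewrite [LHS]surjective_pairing F21.
have F1r y : F (1, y) = (1, (F (1, y)).2).
  by rewrite [LHS]surjective_pairing F12.
have fP : is_aut (fun x => (F (x, 1)).1).
  split=> [x x'|]; first by rewrite Aut_pairMl.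
  (* The inverse of the first component is read off from the inverse of [F] on the first factor. *)
  exists (fun x => (aut_inv_fun F (x, 1)).1) => x.
    by rewrite -F1l aut_funK.
  by case: (aut_inv_fun F (x, 1)) (aut_invK F (x, 1)) => u v; rewrite FE => -[].
have gP : is_aut (fun y => (F (1, y)).2).
  split=> [y y'|]; first by rewrite Aut_pairMr.
  exists (fun y => (aut_inv_fun F (1, y)).2) => y.
    by rewrite -F1r aut_funK.
  by case: (aut_inv_fun F (1, y)) (aut_invK F (1, y)) => u v; rewrite FE => -[].
exists (MkAut (asboolT fP), MkAut (asboolT gP)) => //.
by apply/val_inj/funext => -[x y]; rewrite /= FE.
Qed.

Lemma prod_aut1 : prod_aut (1 : Aut G * Aut H) = 1.
Proof. by apply/val_inj/funext => -[]. Qed.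

Lemma prod_autV (p : Aut G * Aut H) : prod_aut p^-1 = (prod_aut p)^-1.
Proof.
by apply: (mulgI (prod_aut p)); rewrite -prod_autM !mulgV prod_aut1.
Qed.

End AutProduct.

(** * Automorphisms of a product of two free groups *)

Lemma Aut_free_prod (n m : nat)
    (F : Aut (free_of_rank n * free_of_rank m)%type) :
  1 < n -> 1 < m ->
  componentwise_auts _ _ F \/
  (forall x, (F (x, 1)).1 = 1) /\ (forall y, (F (1, y)).2 = 1).
Proof.
move=> n_gt1 m_gt1.
have n01 : Ordinal (ltnW n_gt1) != Ordinal n_gt1 by [].
have m01 : Ordinal (ltnW m_gt1) != Ordinal m_gt1 by [].
have comm1 x y : commute (F (x, 1)).1 (F (1, y)).1.
  by have /(congr1 fst) := Aut_pair_commute F x y.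
have comm2 x y : commute (F (x, 1)).2 (F (1, y)).2.
  by have /(congr1 snd) := Aut_pair_commute F x y.
have gen1 u : exists x y, u = (F (x, 1)).1 * (F (1, y)).1.
  have [[x y]] := Aut_surj F (u, 1); rewrite Aut_pairE => E.
  by exists x, y; case: E.
have gen2 v : exists x y, v = (F (x, 1)).2 * (F (1, y)).2.
  have [[x y]] := Aut_surj F (1, v); rewrite Aut_pairE => E.
  by exists x, y; case: E.
have F1 : F 1 = 1.
  by have [FM _] := autP F; apply: (mulgI (F 1)); rewrite -FM !mulg1.
(* Each target coordinate kills one source factor. If both kill the same factor, [F] is trivial on
   it, against injectivity. *)
have [F11|F12] := commuting_factors n01 comm1 gen1;
  have [F21|F22] := commuting_factors m01 comm2 gen2.
- case: (@free_gen_neq1 _ (Ordinal n_gt1)).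
  suff [] : (free_gen (Ordinal n_gt1), 1) = 1
    :> free_of_rank n * free_of_rank m.
    by [].
  by apply: (@Aut_inj _ F); rewrite F1 [LHS]surjective_pairing F11 F21.
- by right.
- by left; apply: componentwise_autsP.
- case: (@free_gen_neq1 _ (Ordinal m_gt1)).
  suff [] : (1, free_gen (Ordinal m_gt1)) = 1
    :> free_of_rank n * free_of_rank m.
    by [].
  by apply: (@Aut_inj _ F); rewrite F1 [LHS]surjective_pairing F12 F22.
Qed.

(** The two remaining coordinates of [F] are surjective homomorphisms between the factors, one in
    each direction. *)
Lemma swapping_aut_rank (n m : nat)
    (F : Aut (free_of_rank n * free_of_rank m)%type) :
  (forall x, (F (x, 1)).1 = 1) -> (forall y, (F (1, y)).2 = 1) -> n = m.
Proof.
move=> F11 F22; apply/eqP; rewrite eqn_leq; apply/andP; split.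
  apply: (@free_rank_leq m n (fun y => (F (1, y)).1)) => [y y'|u].
    by rewrite Aut_pairMr.
  have [[x y]] := Aut_surj F (u, 1); rewrite Aut_pairE => -[<- _].
  by exists y; rewrite F11 mul1g.
apply: (@free_rank_leq n m (fun x => (F (x, 1)).2)) => [x x'|v].
  by rewrite Aut_pairMl.
have [[x y]] := Aut_surj F (1, v); rewrite Aut_pairE => -[_ <-].
by exists x; rewrite F22 mulg1.
Qed.

(** * From componentwise automorphisms to the isomorphism and the semidirect product *)

Lemma isomorphic_Aut_prod (G H : groupType) :
  (forall F, componentwise_auts G H F) ->
  isomorphic (Aut (G * H)%type) (Aut G * Aut H)%type.
Proof.
move=> cw; have ex (F : Aut (G * H)%type) : exists p, prod_aut p == F.
  by have [p _ <-] := cw F; exists p.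
pose h F := xchoose (ex F).
have hK : cancel h (@prod_aut G H) by move=> F; apply/eqP/(xchooseP (ex F)).
have hM : {morph h : F F' / F * F'}.
  by move=> F F'; apply: (@prod_aut_inj G H); rewrite prod_autM !hK.
pose hI := isMultiplicative.Build _ _ h hM.
pose hm : {multiplicative _ -> _} := HB.pack h hI.
exists hm; exists (@prod_aut G H) => // p.
by apply: (@prod_aut_inj G H); apply: hK.
Qed.

Lemma swap_autM2 (G : groupType) : swap_aut G * swap_aut G = 1.
Proof. by rewrite -expg2 swap_aut_involution. Qed.

Lemma swap_autV (G : groupType) : (swap_aut G)^-1 = swap_aut G.
Proof. by apply: (mulgI (swap_aut G)); rewrite mulgV swap_autM2. Qed.

Lemma cyclic_swap (G : groupType) :
  cyclic_subgroup (swap_aut G) = [set 1; swap_aut G]%classic.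
Proof.
have sX k : swap_aut G ^+ k = if odd k then swap_aut G else 1.
  elim: k => // k IH; rewrite expgS IH /=; case: (odd k) => /=.
    by rewrite swap_autM2.
  by rewrite mulg1.
apply/seteqP; split=> [F [k]|F].
  rewrite sX; case: (odd k); rewrite ?swap_autV ?invg1 => -[]->; by [left | right].
by case=> ->; [exists 0%N; left | exists 1%N; left].
Qed.

Lemma swap_aut_prod (G : groupType) (p : Aut G * Aut G) :
  prod_aut p ^ swap_aut G = prod_aut (p.2, p.1).
Proof.
(* Multiplying by the swap removes the inverse hidden in the conjugate; both sides are then explicit
   maps, equal by computation. *)
by apply: (mulgI (swap_aut G)); rewrite -conjgC; apply: val_inj.
Qed.

(** A componentwise map keeps the second coordinate of [(x, 1)] trivial, whereas the swap puts [x]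
    there. *)
Lemma swap_not_componentwise (G : groupType) :
  componentwise_auts G G (swap_aut G) -> forall x : G, x = 1.
Proof.
case=> p _ pE x; have := congr1 (fun F : Aut _ => F (x, 1)) pE.
have [fM _] := autP p.2.
by case=> _ <-; apply: (mulgI (p.2 1)); rewrite -fM !mulg1.
Qed.

Lemma semidirect_swap (G : groupType) :
  (exists x : G, x <> 1) ->
  (forall F, componentwise_auts G G F \/
     componentwise_auts G G (F * swap_aut G)) ->
  is_semidirect (componentwise_auts G G) (cyclic_subgroup (swap_aut G)).
Proof.
move=> [x0 x0_neq1] cw; rewrite cyclic_swap.
split.
- split; first by apply/mem_set; exists 1 => //; apply: prod_aut1.
  move=> F F' /set_mem[p _ <-] /set_mem[q _ <-]; apply/mem_set.
  by exists (p / q) => //; rewrite prod_autM prod_autV.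
- split; first by apply/mem_set; left.
  move=> F F' /set_mem[]-> /set_mem[]->; apply/mem_set.
  + by left; rewrite divgg.
  + by right; rewrite div1g swap_autV.
  + by right; rewrite divg1.
  + by left; rewrite divgg.
- move=> _ F [p _ <-].
  have cwJ q r : componentwise_auts G G (prod_aut q ^ prod_aut r).
    by rewrite conjgE -prod_autV -!prod_autM; exists (r^-1 * (q * r)).
  have [[q _ <-]|[q _ qE]] := cw F; first exact: cwJ.
  (* Conjugating by [F] is conjugating by [prod_aut q], then by the swap, which only exchanges the
     components. *)
  have -> : F = prod_aut q * swap_aut G.
    by rewrite qE -mulgA swap_autM2 mulg1.
  rewrite conjgM; have [r _ <-] := cwJ p q.
  by rewrite swap_aut_prod; exists (r.2, r.1).
- apply/seteqP; split=> [F [Fcw []]|_ ->] //.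
    by move=> FE; case: x0_neq1; apply: swap_not_componentwise; rewrite -FE.
  by split; [exists 1 => //; apply: prod_aut1 | left].
move=> F; have [Fcw|Fcw] := cw F.
  by exists F, 1; split=> //; [left | rewrite mulg1].
exists (F * swap_aut G), (swap_aut G); split=> //; first by right.
by rewrite -mulgA swap_autM2 mulg1.
Qed.

Theorem corollary3p4 (n m : nat) (n_ge2 : 2 <= n) (m_ge2 : 2 <= m) :
  (n <> m ->
     isomorphic (Aut (free_of_rank n * free_of_rank m)%type)
                (Aut (free_of_rank n) * Aut (free_of_rank m))%type)
  /\
  (n = m ->
     is_semidirect (componentwise_auts (free_of_rank n) (free_of_rank n))
                   (cyclic_subgroup (swap_aut (free_of_rank n)))).
Proof.
split=> [nm|_].
  apply: isomorphic_Aut_prod => F.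
  have [//|[F11 F22]] := Aut_free_prod F n_ge2 m_ge2.
  by case: nm; apply: swapping_aut_rank F11 F22.
apply: semidirect_swap.
  by exists (free_gen (Ordinal n_ge2)); apply: free_gen_neq1.
move=> F; have [|[F11 F22]] := Aut_free_prod F n_ge2 n_ge2; first by left.
(* Products act left to right, so [F * swap_aut _] is [F] with its output coordinates exchanged. *)
by right; apply: componentwise_autsP => [x|y]; [apply: F11 | apply: F22].
Qed.
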